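(* There exists a universal constant $C$ such that $$\mathcal{P}\bigl(E^{\sigma}<Cn\bigr)=1-o(1)\qquad\text{as } n\to\infty,$$ where $\mathcal{P}$ is the uniform probability measure on the set $S_{[-n,n]}$ of permutations of $[-n,n]=\{-n,-n+1,\ldots,n\}$, and $E^{\sigma}=\max_{x,y\in[-n,n]}\mathbb{E}^{\sigma}_{x}(\tau_y)$ is the worst-case expected hitting time of the permuted walk $X_\sigma$.
   Context: For a positive integer $n$, $[-n,n]$ denotes the set of integers $\{-n,-n+1,\ldots,n\}$ and $S_{[-n,n]}$ the set of its permutations. Given $\sigma\in S_{[-n,n]}$, the permuted walk $X_\sigma$ is the discrete-time Markov chain on $[-n,n]$ with the following transitions: from $x\notin\{-n,n\}$ it jumps to $\sigma(x-1)$ or $\sigma(x+1)$ with probability $1/2$ each; from $-n$ it jumps to $\sigma(-n)$ or $\sigma(-n+1)$ with probability $1/2$ each; from $n$ it jumps to $\sigma(n-1)$ or $\sigma(n)$ with probability $1/2$ each. For $y\in[-n,n]$, $\tau_y=\min\{t\ge 0: X_\sigma(t)=y\}$ is the hitting time of $y$, and $\mathbb{E}^\sigma_x(\tau_y)$ is its expectation when $X_\sigma$ is started from $x$. *)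

(* Defs.v *)
From mathcomp Require Import all_boot all_order all_fingroup all_algebra.
From mathcomp Require Import all_classical all_reals all_analysis.
From mathcomp Require Import lra.

Set Implicit Arguments.
Unset Strict Implicit.
Unset Printing Implicit Defensive.

Import Order.TTheory GRing.Theory Num.Theory.

Local Open Scope classical_set_scope.
Local Open Scope ring_scope.

(* A realization, on some probability space, of the chain with transition matrix
   Q started from x. mc_trans is the Markov property multiplied out:
   P(X_0 = s_0, ..., X_t+1 = s_t+1) = P(X_0 = s_0, ..., X_t = s_t) Q(s_t, s_t+1),
   so nothing is conditioned on a null event. *)
Record markov_chain (R : realType) (S : finType) (Q : S -> S -> R) (x : S) :=
  MarkovChain {
  mc_display : measure_display;
  mc_space : measurableType mc_display;
  mc_prob : probability mc_space R;
  mc_proc : nat -> mc_space -> S;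
  mc_meas : forall t s, measurable [set w | mc_proc t w = s];
  mc_init : mc_prob [set w | mc_proc 0 w = x] = 1%E;
  mc_trans : forall t (s : nat -> S),
    mc_prob [set w | forall k, (k <= t.+1)%N -> mc_proc k w = s k] =
    (mc_prob [set w | forall k, (k <= t)%N -> mc_proc k w = s k]
      * (Q (s t) (s t.+1))%:E)%E }.

Arguments mc_proc {R S Q x} m t w.

(* The infimum over the empty set is +oo, so a path that never visits y has
   infinite hitting time. *)
Definition hitting_time (R : realType) (T : Type) (S : finType)
    (X : nat -> T -> S) (y : S) (w : T) : \bar R :=
  ereal_inf [set (t%:R)%:E | t in [set t | X t w = y]].

Definition expected_hitting_time (R : realType) (S : finType)
    (Q : S -> S -> R) (x : S) (X : markov_chain Q x) (y : S) : \bar R :=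
  (\int[mc_prob X]_w hitting_time R (mc_proc X) y w)%E.

(* The index i : 'I_(2n+1) stands for the integer i - n of [-n, n]; the
   endpoints -n and n are 0 and 2n. *)
Definition seg (n : nat) := 'I_n.*2.+1.

Definition left_nbr (n : nat) (x : seg n) : seg n := inord x.-1.

Definition right_nbr (n : nat) (x : seg n) : seg n := inord (minn x.+1 n.*2).

(* The two neighbours of x are distinct as soon as 0 < n; left_nbr fixes -n and
   right_nbr fixes n, so that -n moves to sigma (-n) or sigma (-n + 1) and n moves
   to sigma (n - 1) or sigma n. *)
Definition permuted_walk (R : realType) (n : nat) (sigma : {perm seg n})
    (x z : seg n) : R :=
  (z == sigma (left_nbr x))%:R / 2 + (z == sigma (right_nbr x))%:R / 2.

Definition max_expected_hitting_time (R : realType) (S : finType)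
    (Q : S -> S -> R) (X : forall x, markov_chain Q x) : \bar R :=
  \big[maxe/-oo%E]_(x : S) \big[maxe/-oo%E]_(y : S)
    expected_hitting_time (X x) y.

Definition uniform_measure (R : realType) (T : finType) (A : pred T) : R :=
  #|A|%:R / #|T|%:R.

(* A realization of the walk driven by independent fair coins, the binary digits
   of a uniform point w of [0, 1]: Num.truncn (2 ^+ t * w) encodes the first t
   coins. *)
Section existence.
Variable R : realType.

Local Notation P := (uniform_prob (@ltr01 R)).
Local Notation d t w := (Num.truncn (2 ^+ t * w)).

Lemma digits_half t (w : R) : (d t.+1 w)./2 = d t w.
Proof.
have [w0|w0] := leP 0 w; last first.
  have neg k : d k w = 0%N.
    apply/truncn0Pn; rewrite -ltNge (lt_trans _ (@ltr01 R))//.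
    by rewrite pmulr_rlt0// exprn_gt0.
  by rewrite !neg.
have w1 : 0 <= 2 ^+ t.+1 * w by rewrite mulr_ge0// exprn_ge0.
have /andP[h1 h2] := truncn_itv w1.
apply/esym/truncn_def; set v := d t.+1 w in h1 h2 *.
have hv := odd_double_half v.
have e1 : v%:R = (odd v)%:R + v./2%:R * 2 :> R.
  by rewrite -[in LHS]hv natrD -muln2 natrM.
have o0 : (0 : R) <= (odd v)%:R by [].
have o1 : ((odd v)%:R : R) <= 1 by case: (odd v).
move: h1 h2; rewrite -!natr1 e1 exprS -mulrA; set z := 2 ^+ t * w.
by move=> h1 h2; apply/andP; split; lra.
Qed.

Lemma digits_itv t k : k != 0%N ->
  [set w : R | d t w = k] = `[k%:R / 2 ^+ t, k.+1%:R / 2 ^+ t[%classic.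
Proof.
move=> k0; have t0 : (0 : R) < 2 ^+ t by rewrite exprn_gt0.
apply/seteqP; split=> w /=; rewrite in_itv/= ler_pdivrMr// ltr_pdivlMr//.
  move=> wk; have w0 : 0 <= 2 ^+ t * w.
    rewrite leNgt; apply/negP => w0; move/eqP: k0; apply; rewrite -wk.
    by apply/truncn0Pn; rewrite -ltNge (lt_trans w0).
  by have := truncn_itv w0; rewrite wk mulrC.
by rewrite mulrC => h; exact: truncn_def.
Qed.

Lemma digits_itv0 t :
  [set w : R | d t w = 0%N] = `]-oo, 1 / 2 ^+ t[%classic.
Proof.
have t0 : (0 : R) < 2 ^+ t by rewrite exprn_gt0.
apply/seteqP; split=> w /=; rewrite in_itv/= ltr_pdivlMr// mulrC ltNge.
  by move/truncn0Pn.
by move=> h; exact/truncn0Pn.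
Qed.

Lemma measurable_digit t k :
  measurable [set w : measurableTypeR R | d t w = k].
Proof.
by have [->|k0] := eqVneq k 0%N; [rewrite digits_itv0|rewrite digits_itv].
Qed.

Lemma measurable_digits t (L : pred nat) :
  measurable [set w : measurableTypeR R | L (d t w)].
Proof.
rewrite (_ : [set w | _] =
    \bigcup_(k in [set k | L k]) [set w : measurableTypeR R | d t w = k]).
  by apply: bigcup_measurable => k _; exact: measurable_digit.
apply/seteqP; split=> [w /= Lw|w [k /= Lk wk]]; last by rewrite wk.
by exists (d t w).
Qed.

Lemma uniform_itv (A : set (measurableTypeR R)) (a b : R) : measurable A -> 0 <= a -> a <= b -> b <= 1 ->
  A `&` `[0, 1] = `[a, b[%classic -> P A = (b - a)%:E.
Proof.
move=> mA a0 ab b1 Aab; rewrite /uniform_prob integral_uniform_pdf Aab.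
rewrite (eq_integral (cst 1%:E)) => [|w]; last first.
  rewrite inE/= in_itv/= => /andP[aw wb]; rewrite /uniform_pdf.
  by rewrite (le_trans a0 aw) (ltW (lt_le_trans wb b1)) subr0 invr1.
rewrite integral_cst//= mul1e lebesgue_measure_itv/= lte_fin.
case: ltP => // ba; have /eqP -> : a == b by rewrite eq_le ab.
by rewrite subrr.
Qed.

Lemma prob_digit t k : (k < 2 ^ t)%N ->
  P [set w | d t w = k] = (2 ^- t)%:E.
Proof.
move=> kt; have t0 : (0 : R) < 2 ^+ t by rewrite exprn_gt0.
have kt1 : k.+1%:R / 2 ^+ t <= 1 :> R.
  by rewrite ler_pdivrMr// mul1r -natrX ler_nat.
have kt0 : 0 <= k%:R / 2 ^+ t :> R by rewrite divr_ge0// ltW.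
have kk : k%:R / 2 ^+ t <= k.+1%:R / 2 ^+ t :> R.
  by rewrite ler_pM2r ?invr_gt0// ler_nat.
suff e : [set w : R | d t w = k] `&` `[0, 1] =
    `[k%:R / 2 ^+ t, k.+1%:R / 2 ^+ t[%classic.
  rewrite (uniform_itv (measurable_digit t k) kt0 kk kt1 e).
  by rewrite -mulrBl -natr1 addrAC subrr add0r mul1r.
have [k0|k0] := eqVneq k 0%N.
  rewrite k0 digits_itv0; apply/seteqP; split => w /=; rewrite !in_itv/= mul0r.
    by move=> [-> /andP[->]].
  move=> /andP[-> w1]; split=> //=; rewrite k0 in kt1.
  exact: ltW (lt_le_trans w1 kt1).
rewrite digits_itv//; apply/seteqP; split => [w [] //|w /= kw]; split => //.
move: kw; rewrite !in_itv/= => /andP[kw wk]; apply/andP; split.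
  exact: le_trans kw.
exact: ltW (lt_le_trans wk kt1).
Qed.

Lemma prob_digits_sum t (L : pred nat) N : (N <= 2 ^ t)%N ->
  P [set w | L (d t w) && (d t w < N)%N] =
  ((\sum_(0 <= k < N) (L k)%:R) / 2 ^+ t)%:E.
Proof.
elim: N => [_|N IH Nt].
  rewrite big_geq// mul0r (_ : [set w | _] = set0) ?measure0//.
  by apply/seteqP; split=> w //=; rewrite ltn0 andbF.
rewrite big_nat_recr//= mulrDl EFinD -IH ?(ltnW Nt)//.
rewrite (_ : [set w | L (d t w) && (d t w < N.+1)%N] =
    [set w | L (d t w) && (d t w < N)%N] `|`
    [set w | L (d t w) && (d t w == N)]); last first.
  apply/seteqP; split => w /=.
    by move=> /andP[->]; rewrite ltnS leq_eqVlt => /orP[->|->]; [right|left].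
  by move=> [|] /andP[-> h]; rewrite ltnS leq_eqVlt h ?orbT.
rewrite measureU//; first last.
- apply/seteqP; split => w //= [/andP[_ h] /andP[_ /eqP e]].
  by rewrite e ltnn in h.
- exact: (@measurable_digits t (fun v => L v && (v == N))).
- exact: (@measurable_digits t (fun v => L v && (v < N)%N)).
congr (_ + _)%E; case LN: (L N).
  rewrite mul1r -(prob_digit Nt); congr (P _).
  by apply/seteqP; split => w /=; [move=> /andP[_ /eqP]|move=> ->; rewrite LN eqxx].
rewrite mul0r (_ : [set w | L (d t w) && (d t w == N)] = set0) ?measure0//.
by apply/seteqP; split=> w //= /andP[+ /eqP e]; rewrite e LN.
Qed.

Lemma prob_digits t (L : pred nat) :
  P [set w | L (d t w)] = ((\sum_(0 <= k < 2 ^ t) (L k)%:R) / 2 ^+ t)%:E.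
Proof.
rewrite -prob_digits_sum//.
have mle (L' : pred nat) : measurable [set w : measurableTypeR R | L' (d t w)].
  exact: measurable_digits.
rewrite (_ : [set w | L _] = [set w | L (d t w) && (d t w < 2 ^ t)%N] `|`
    [set w | L (d t w) && (2 ^ t <= d t w)%N]); last first.
  apply/seteqP; split => w /=; last by move=> [|] /andP[].
  by move=> ->; case: ltnP => _; [left|right].
have m1 := mle (fun v => L v && (v < 2 ^ t)%N).
have m2 := mle (fun v => L v && (2 ^ t <= v)%N).
rewrite measureU//; last first.
  by apply/seteqP; split => w //= [/andP[_ +] /andP[_]]; rewrite ltnNge => /negP.
suff e : P [set w | L (d t w) && (2 ^ t <= d t w)%N] = 0%E.
  by rewrite [X in (_ + X)%E = _]e adde0.
apply/eqP; rewrite eq_le measure_ge0 andbT.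
have mN := mle (fun v => (2 ^ t <= v)%N).
apply: (@le_trans _ _ (P [set w | (2 ^ t <= d t w)%N])) => /=.
  by apply: le_measure; rewrite ?inE// => w /= /andP[].
rewrite (_ : [set w | _] = ~` [set w | (d t w < 2 ^ t)%N]); last first.
  apply/seteqP; split => w /= => [h|/negP]; last by rewrite -leqNgt.
  by apply/negP; rewrite -leqNgt.
have mC := mle (fun v => (v < 2 ^ t)%N).
rewrite probability_setC//.
have /= -> := @prob_digits_sum t predT (2 ^ t)%N (leqnn _).
rewrite big_const_nat subn0 iter_addr_0 natrX divff ?subee//.
Qed.

Variables (S : finType) (step : bool -> S -> S) (x0 : S).

Definition coin_kernel (x z : S) : R :=
  (z == step false x)%:R / 2 + (z == step true x)%:R / 2.

Fixpoint coin_path (t v : nat) : S :=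
  if t is t'.+1 then step (odd v) (coin_path t' v./2) else x0.

Definition coin_proc (t : nat) (w : measurableTypeR R) : S :=
  coin_path t (d t w).

Fixpoint follows (s : nat -> S) (t v : nat) : bool :=
  if t is t'.+1 then follows s t' v./2 && (coin_path t v == s t)
  else x0 == s 0.

Lemma followsE (s : nat -> S) t :
  [set w | forall k, (k <= t)%N -> coin_proc k w = s k] =
  [set w | follows s t (d t w)].
Proof.
apply/seteqP; split => w /=; elim: t => [|t IH] /=.
- by move=> /(_ 0%N isT) <-; rewrite eqxx.
- move=> h; rewrite digits_half IH => [|k kt]; last by apply: h; exact: leqW.
  by rewrite -(h t.+1)//= /coin_proc/= digits_half.
- by move=> /eqP xs k; rewrite leqn0 => /eqP ->.
- rewrite digits_half => /andP[/IH h /eqP ht] k.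
  rewrite leq_eqVlt => /orP[/eqP ->|]; last exact: h.
  by rewrite /coin_proc/= digits_half.
Qed.

Lemma follows_last (s : nat -> S) t v : follows s t v -> coin_path t v = s t.
Proof. by case: t => [/eqP //|t /= /andP[_ /eqP]]. Qed.

Lemma sum_double (f : nat -> R) N :
  \sum_(0 <= k < N.*2) f k = \sum_(0 <= k < N) (f k.*2 + f k.*2.+1).
Proof.
elim: N => [|N IH]; first by rewrite !big_geq.
by rewrite doubleS !big_nat_recr//= IH addrA.
Qed.

Lemma coin_trans t (s : nat -> S) :
  P [set w | forall k, (k <= t.+1)%N -> coin_proc k w = s k] =
    (P [set w | forall k, (k <= t)%N -> coin_proc k w = s k]
      * (coin_kernel (s t) (s t.+1))%:E)%E.
Proof.
rewrite !followsE !prob_digits -EFinM; congr EFin.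
rewrite expnS mul2n sum_double exprS invfM mulrA [RHS]mulrAC; congr (_ / _).
rewrite !mulr_suml; apply: eq_bigr => k _ /=.
rewrite doubleK uphalf_double odd_double/=.
case: (boolP (follows s t k)) => [/follows_last ->|_]; last by rewrite !mul0r addr0 mul0r.
by rewrite /coin_kernel mul1r /= ![s t.+1 == _]eq_sym mulrDl.
Qed.

Lemma coin_chain : inhabited (markov_chain coin_kernel x0).
Proof.
have mX t s : measurable [set w | coin_proc t w = s].
  rewrite (_ : [set w | _] = [set w | coin_path t (d t w) == s]).
    exact: (@measurable_digits t (fun v => coin_path t v == s)).
  by apply/seteqP; split => w /= /eqP.
constructor; refine (@MarkovChain _ _ _ _ _ _ P coin_proc mX _ coin_trans).
rewrite (_ : [set w | _] = setT) ?probability_setT//.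
by apply/seteqP; split.
Qed.

End existence.

(* Hence a statement about all realizations of the permuted walk is not vacuous. *)
Lemma permuted_walk_exists (R : realType) (n : nat) (sigma : {perm seg n})
    (x : seg n) : inhabited (markov_chain (permuted_walk R sigma) x).
Proof.
exact: (coin_chain R (fun b z => sigma (if b then right_nbr z else left_nbr z))).
Qed.

(* Main.v *)
Require Import Defs.
From mathcomp Require Import all_boot all_order all_fingroup all_algebra.
From mathcomp Require Import all_classical all_reals all_analysis.
From mathcomp Require Import measurable_realfun ring lra zify.

Set Implicit Arguments.
Unset Strict Implicit.
Unset Printing Implicit Defensive.

Import Order.TTheory GRing.Theory Num.Theory.
Import numFieldNormedType.Exports.

Local Open Scope ring_scope.

(** Let N = 2n + 1 and let avg be the averaging operator of the simple walk on the
    segment, so that the permuted walk acts on functions by f |-> avg (f o sigma).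
    Both avg and composition with sigma preserve sums, and the uniform law is
    stationary.

    Expansion. Join left_nbr x to right_nbr x for every x. This gives a connected
    2-regular multigraph on the segment, and |f|^2 - |avg f|^2 is a quarter of the
    sum of the squared increments of f along its edges. Its union with its image
    under a uniform permutation is an expander with high probability
    ([card_non_expanders]): a set A violates expansion only if A and its preimage
    under sigma both have a boundary much smaller than their size a. A set is
    determined by its boundary up to one bit, so there are few such sets, while the
    preimage of A is uniform among the 'C(N, a) sets of size a. The union bound
    over sets gives a failure probability O(1 / N).

    Contraction. By Cheeger's inequality ([cheeger]) the increments of a mean zero
    function g along the edges of the two graphs have a sum of squares of order at
    least |g|^2. In two steps of the walk the square norm drops by a quarter
    of the squared increments along both graphs, so that it is multiplied by a
    constant less than 1 ([avg_perm_contraction]).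

    Hitting times. Let T be the transition operator of the walk. The iterates of
    T on 1_y - 1/N are bounded, uniformly, by a geometric sequence, with no
    dependence on N because the norm of 1_y is 1. Their sum g therefore
    is bounded by a constant, and it solves g - T g = 1_y - 1/N, so that - N g is
    up to an additive constant a function which decreases by 1 on average at each
    step taken outside y. Comparing the expected hitting time with such a Lyapunov
    function ([expected_hitting_time_le]) bounds it by O(N), for all starting points
    and all targets at once ([contraction_hitting_time]). *)

(** * Hitting times and Lyapunov functions *)

Definition transition (R : realType) (S : finType) (Q : S -> S -> R)
  (f : S -> R) (x : S) : R := \sum_z Q x z * f z.

Section Lyapunov.
Local Open Scope classical_set_scope.
Variables (R : realType) (S : finType) (Q : S -> S -> R) (x : S).
Variable X : markov_chain Q x.
Local Notation P := (mc_prob X).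
Local Notation Y := (mc_proc X).
Implicit Types (D : nat -> pred S) (t j : nat) (s : nat -> S).

(** Allowing a different set of states at each time lets the same notion
    express the cylinders of the definition of a chain, the event that y has
    been avoided so far, and everything in between. *)
Definition paths_in D t : set (mc_space X) :=
  [set w | forall k, (k <= t)%N -> D k (Y k w)].

Lemma measurable_proc (A : pred S) k : measurable [set w | A (Y k w)].
Proof.
rewrite (_ : [set w | _] = \bigcup_(z in [set z | A z]) [set w | Y k w = z]).
  apply: fin_bigcup_measurable => [|z _]; last exact: mc_meas.
  exact: finite_finset.
apply/seteqP; split=> [w /= Aw|w [z /= Az wz]]; last by rewrite wz.
by exists (Y k w).
Qed.

Lemma measurable_paths_in D t : measurable (paths_in D t).
Proof.
rewrite (_ : paths_in D t = \bigcap_(k in `I_t.+1) [set w | D k (Y k w)]).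
  by apply: fin_bigcap_measurable => // k _; exact: measurable_proc.
by apply/seteqP; split=> w h k /= /h.
Qed.

Lemma prob_split (E : set (mc_space X)) k : measurable E ->
  P E = (\sum_u P (E `&` [set w | Y k w = u]))%E.
Proof.
move=> mE.
have {1}-> : E = \bigcup_(u in [set: S]) (E `&` [set w | Y k w = u]).
  by apply/seteqP; split=> [w Ew|w [u _ []]//]; exists (Y k w).
rewrite measure_fin_bigcup//; last first.
- by move=> u _; apply: measurableI => //; exact: mc_meas.
- by move=> u v _ _ [w [[_ /= <-] [_ /= <-]]].
- exact: finite_finset.
- rewrite -(_ : [set` index_enum S] = [set: S]) -?fsbig_seq ?index_enum_uniq//.
  by apply/seteqP; split=> u //= _; exact: mem_index_enum.
Qed.

Definition pin D k u : nat -> pred S :=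
  fun i => if i == k then (pred1 u : pred S) else D i.

Lemma paths_in_split D k t : (k <= t)%N ->
  P (paths_in D t) = (\sum_(u | D k u) P (paths_in (pin D k u) t))%E.
Proof.
move=> kt; rewrite (prob_split k (measurable_paths_in D t)) [RHS]big_mkcond/=.
apply: eq_bigr => u _; case: ifPn => Du.
  congr (P _); apply/seteqP; split => w /=.
    move=> [h <-] i it; rewrite /pin; case: eqVneq => [->|_] /=; first exact: eqxx.
    exact: h.
  move=> h; split; last by have := h _ kt; rewrite /pin eqxx => /eqP.
  move=> i it; have := h _ it; rewrite /pin; case: eqVneq => [->|//].
  by move=> /eqP ->.
rewrite (_ : _ `&` _ = set0) ?measure0//; apply/seteqP; split => w //= [h wu].
by move: Du; rewrite -wu h.
Qed.

(** The Markov property is assumed for cylinders only, that is when the state is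
    prescribed at every time. It extends to events that prescribe the last two
    states and merely constrain the earlier ones, by freeing these one at a time:
    both sides are additive in the value taken at time j. *)
Lemma paths_in_step D t u v : D t = pred1 u -> D t.+1 = pred1 v ->
  P (paths_in D t.+1) = (P (paths_in D t) * (Q u v)%:E)%E.
Proof.
move=> Dt DSt.
(* All the states from time j on are prescribed, by s. *)
suff gen j : (j <= t)%N -> forall D s, D t = pred1 u -> D t.+1 = pred1 v ->
    (forall k, (j <= k <= t.+1)%N -> D k = pred1 (s k)) ->
    P (paths_in D t.+1) = (P (paths_in D t) * (Q u v)%:E)%E.
  apply: (gen t (leqnn t) D (fun k => if k == t then u else v) Dt DSt) => k.
  rewrite leq_eqVlt => /andP[/predU1P[<- _|tk]]; first by rewrite eqxx.
  by rewrite gtn_eqF// leq_eqVlt ltnS leqNgt tk orbF => /eqP ->.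
elim: j => [_|j IH jt] {D Dt DSt} D s Dt DSt Ds.
  have su : s t = u.
    apply/eqP; rewrite -[_ == _]/((pred1 u : pred S) (s t)) -Dt.
    by rewrite Ds ?leqnSn//= eqxx.
  have sv : s t.+1 = v.
    apply/eqP; rewrite -[_ == _]/((pred1 v : pred S) (s t.+1)) -DSt.
    by rewrite Ds ?leqnn//= eqxx.
  have {}Ds r : (r <= t.+1)%N -> paths_in D r =
      [set w | forall k, (k <= r)%N -> mc_proc X k w = s k].
    move=> rt; apply/seteqP; split => w /= h k kr; have := h k kr;
      rewrite (Ds k) ?(leq_trans kr)//; first by move=> /eqP.
    by move=> ->; exact: eqxx.
  by rewrite !Ds// mc_trans su sv.
rewrite !(@paths_in_split D j)//; [|exact: ltnW|exact: leqW (ltnW jt)].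
rewrite ge0_sume_distrl//; apply: eq_bigr => z _.
apply: (IH (ltnW jt) _ (fun k => if k == j then z else s k)).
- by rewrite /pin gtn_eqF.
- by rewrite /pin gtn_eqF// ltnS ltnW.
- move=> k; rewrite /pin leq_eqVlt => /andP[/predU1P[<- _|jk kt]].
    by rewrite eqxx.
  by rewrite gtn_eqF// Ds// jk.
Qed.

(** The law at time t of the chain killed on reaching y. *)
Definition killed_law (y u : S) t : R :=
  fine (P (paths_in (pin (fun=> predC1 y) t u) t)).

Definition survival (y : S) t : R := fine (P (paths_in (fun=> predC1 y) t)).

Lemma fin_num_prob (A : set (mc_space X)) : measurable A -> P A \is a fin_num.
Proof. by move=> mA; exact: fin_num_measure. Qed.

Lemma survivalE y t : survival y t = \sum_(u | u != y) killed_law y u t.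
Proof.
rewrite /survival (@paths_in_split _ t t)// -sum_fine//= => u _.
exact/fin_num_prob/measurable_paths_in.
Qed.

Lemma killed_law_step y v t : v != y ->
  killed_law y v t.+1 = \sum_(u | u != y) killed_law y u t * Q u v.
Proof.
move=> vy; rewrite /killed_law (@paths_in_split _ t t.+1)//.
rewrite -sum_fine => [|u _]; last first.
  exact/fin_num_prob/measurable_paths_in.
apply: eq_big => u; first by rewrite /pin/= ltn_eqF.
move=> uy; rewrite (@paths_in_step _ t u v).
- rewrite fineM//; last exact/fin_num_prob/measurable_paths_in.
  congr (fine (P _) * _); apply/seteqP; split => w /= h k kt; have := h k kt;
    by rewrite /pin; case: (k =P t) => // _; rewrite ltn_eqF// ltnS.
- by rewrite /pin eqxx.
- by rewrite /pin gtn_eqF// eqxx.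
Qed.

Lemma killed_law_ge0 y u t : 0 <= killed_law y u t.
Proof. exact/fine_ge0/measure_ge0. Qed.

Lemma killed_law0 y u : killed_law y u 0 = (u == x)%:R.
Proof.
have e : paths_in (pin (fun=> predC1 y) 0 u) 0 = [set w | Y 0 w = u].
  apply/seteqP; split => w /=; first by move=> /(_ 0%N (leqnn _)) /eqP.
  by move=> h k; rewrite leqn0 => /eqP ->; apply/eqP.
rewrite /killed_law e; case: eqVneq => [->|ux]; first by rewrite mc_init.
suff -> : P [set w | Y 0 w = u] = 0%E by [].
apply/eqP; rewrite eq_le measure_ge0 andbT.
have /= <- : P (~` [set w | Y 0 w = x]) = 0%E.
  rewrite probability_setC; last exact: mc_meas.
  by rewrite mc_init subee.
apply: le_measure; rewrite ?inE; [exact: mc_meas|exact/measurableC/mc_meas|].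
by move=> w /= -> /eqP; apply/negP.
Qed.

(** V x is an initial budget: whenever the chain moves from a state other than
    y, the expected value of V drops by at least 1, so that the mass still alive
    at time t is paid for by the decrease of the average of V under the killed
    law. *)
Lemma sum_survival_le (V : S -> R) y T : (forall u v, 0 <= Q u v) ->
    (forall z, 0 <= V z) ->
    (forall z, z != y -> 1 + transition Q V z <= V z) ->
  \sum_(t < T) survival y t <= V x.
Proof.
move=> Q0 V0 VQ.
have h0 : \sum_(u | u != y) killed_law y u 0 * V u <= V x.
  rewrite big_mkcond (bigD1 x)//= killed_law0 eqxx mul1r big1 => [|u ux].
    by rewrite addr0; case: ifP.
  by rewrite killed_law0 (negbTE ux) mul0r if_same.
apply: le_trans h0; rewrite -[leLHS]addr0.
suff : \sum_(t < T) survival y t + \sum_(u | u != y) killed_law y u T * V u <=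
       \sum_(u | u != y) killed_law y u 0 * V u.
  apply: le_trans; rewrite lerD2l; apply: sumr_ge0 => u _.
  by rewrite mulr_ge0// killed_law_ge0.
elim: T => [|T IH]; first by rewrite big_ord0 add0r.
apply: le_trans IH; rewrite big_ord_recr/= -addrA lerD2l survivalE.
under [X in _ + X <= _]eq_bigr => v vy do rewrite (killed_law_step _ vy) mulr_suml.
rewrite exchange_big/= -big_split/=; apply: ler_sum => u uy.
under eq_bigr do rewrite -mulrA.
rewrite -mulr_sumr -{1}[killed_law y u T]mulr1 -mulrDr ler_wpM2l ?killed_law_ge0//.
apply: le_trans (VQ u uy); rewrite lerD2l /transition [leRHS](bigD1 y)//=.
by rewrite lerDr mulr_ge0.
Qed.

(** The hitting time counts the times up to which y has been avoided. As a series
    of indicators it is visibly measurable, and it is integrated term by term. *)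
Lemma hitting_timeE y w : hitting_time R Y y w =
  (\sum_(t <oo) (\1_(paths_in (fun=> predC1 y) t) w)%:E)%E.
Proof.
have ind0 t : (0 <= (\1_(paths_in (fun=> predC1 y) t) w)%:E :> \bar R)%E.
  by rewrite lee_fin.
have [[t0 yt0]|never] := pselect (exists t, Y t w == y).
  have [t /eqP yt tmin] := ex_minnP (ex_intro (fun t => Y t w == y) t0 yt0).
  rewrite (nneseries_split 0 t)// add0n [X in (_ + X)%E]eseries0 ?adde0.
    rewrite (eq_big_nat _ _ (F2 := fun=> 1%E)) => [|k /andP[_ kt]].
      rewrite sumEFin sumr_const_nat subn0.
      apply/eqP; rewrite eq_le; apply/andP; split.
        by apply: ereal_inf_lbound; exists t.
      apply: le_ereal_inf_tmp => _ [k /= /eqP yk <-].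
      by rewrite lee_fin ler_nat tmin.
    rewrite indicE mem_set// => i ik; apply/negP => yi.
    by have := leq_ltn_trans (tmin _ yi) (leq_ltn_trans ik kt); rewrite ltnn.
  move=> k tk _; rewrite indicE memNset// => h.
  by have := h _ tk; rewrite /= yt eqxx.
apply/eqP; rewrite /hitting_time (_ : [set t | _] = set0)/=; last first.
  by apply/seteqP; split=> // t yt; case: never; exists t; apply/eqP.
rewrite image_set0 ereal_inf0 eq_sym; apply/eqP/eqyP => A A0.
have [T AT] : exists T : nat, A <= T%:R.
  by exists (Num.truncn A).+1; apply/ltW/truncnS_gt.
apply: le_trans (nneseries_lim_ge T (fun t _ _ => ind0 t)).
rewrite (eq_big_nat _ _ (F2 := fun=> 1%E)) => [|k _].
  by rewrite sumEFin sumr_const_nat subn0 lee_fin.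
by rewrite indicE mem_set// => i _; apply/negP => yi; apply: never; exists i.
Qed.

Lemma expected_hitting_time_le (V : S -> R) y : (forall u v, 0 <= Q u v) ->
    (forall z, 0 <= V z) ->
    (forall z, z != y -> 1 + transition Q V z <= V z) ->
  (expected_hitting_time X y <= (V x)%:E)%E.
Proof.
move=> Q0 V0 VQ; rewrite /expected_hitting_time.
under eq_integral do rewrite hitting_timeE.
have mP t := measurable_paths_in (fun=> predC1 y) t.
rewrite integral_nneseries//; last first.
  by move=> t; apply/measurable_EFinP/measurable_indic.
apply: (@le_trans _ _ (\sum_(t <oo) P (paths_in (fun=> predC1 y) t))%E).
  by apply: lee_nneseries => t _; rewrite ?integral_indic ?setIT ?integral_ge0.
apply: lime_le; first exact: is_cvg_nneseries.
apply: nearW => T; rewrite big_mkord.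
rewrite (eq_bigr (fun t : 'I_T => (survival y t)%:E)) => [|t _].
  by rewrite sumEFin lee_fin; exact: sum_survival_le.
by rewrite /survival fineK//; exact/fin_num_prob.
Qed.

End Lyapunov.

(** * From contraction in mean square to hitting times *)
Section Contraction.
Variables (R : realType) (S : finType) (Q : S -> S -> R) (rho : R).
Local Notation T := (transition Q).
Hypothesis Q0 : forall u v, 0 <= Q u v.
Hypothesis Q1 : forall u, \sum_v Q u v = 1.
Hypothesis rho0 : 0 <= rho.
Hypothesis rho1 : rho < 1.
Hypothesis mean_zero : forall f : S -> R, \sum_u f u = 0 -> \sum_u T (T f) u = 0.
Hypothesis contraction : forall f : S -> R, \sum_u f u = 0 ->
  \sum_u T (T f) u ^+ 2 <= rho ^+ 2 * \sum_u f u ^+ 2.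

Local Notation U := (fun f : S -> R => T (T f)).
Local Notation N := (#|S|%:R : R).

Lemma transition_le (f : S -> R) M u : (forall v, `|f v| <= M) -> `|T f u| <= M.
Proof.
move=> fM; apply: le_trans (ler_norm_sum _ _ _) _.
rewrite -[leRHS]mul1r -(Q1 u) mulr_suml; apply: ler_sum => v _.
by rewrite normrM (ger0_norm (Q0 _ _)) ler_wpM2l.
Qed.

Lemma transition_sum (I : Type) (r : seq I) (F : I -> S -> R) u :
  T (fun v => \sum_(i <- r) F i v) u = \sum_(i <- r) T (F i) u.
Proof.
rewrite /transition exchange_big/=; apply: eq_bigr => v _.
by rewrite mulr_sumr.
Qed.

Lemma transition_affine (a b : R) (f g : S -> R) u :
  T (fun v => a * (b - (f v + g v))) u = a * (b - (T f u + T g u)).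
Proof.
have eb : b = \sum_v Q u v * b by rewrite -mulr_suml Q1 mul1r.
rewrite {2}eb /transition -big_split/= -sumrB mulr_sumr.
by apply: eq_bigr => v _; ring.
Qed.

Definition centered_delta (y u : S) : R := (u == y)%:R - N^-1.

Lemma cardR_gt0 (y : S) : 0 < N.
Proof. by rewrite ltr0n; apply/card_gt0P; exists y. Qed.

Lemma sum_centered_delta y : \sum_u centered_delta y u = 0.
Proof.
rewrite sumrB (bigD1 y)//= eqxx big1 => [|u /negbTE ->//].
rewrite sumr_const -[N^-1 *+ _]mulr_natl divff ?addr0 ?subrr//.
exact/lt0r_neq0/(cardR_gt0 y).
Qed.

Lemma sqr_centered_delta y : \sum_u centered_delta y u ^+ 2 <= 1.
Proof.
have N0 := cardR_gt0 y.
have -> : \sum_u centered_delta y u ^+ 2 =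
    \sum_u (u == y)%:R - N^-1 * \sum_u centered_delta y u
      - N^-1 * \sum_u (u == y)%:R.
  rewrite !mulr_sumr -!sumrB; apply: eq_bigr => u _; rewrite /centered_delta.
  by case: (u == y) => /=; ring.
rewrite sum_centered_delta (bigD1 y)//= eqxx big1 => [|u /negbTE ->//].
by rewrite mulr0 subr0 addr0 mulr1 gerBl invr_ge0 ltW.
Qed.

Definition delta_iter y k := iter k U (centered_delta y).

Lemma delta_iter_mean_zero y k : \sum_u delta_iter y k u = 0.
Proof.
by elim: k => [|k IH]; [exact: sum_centered_delta|exact: mean_zero].
Qed.

(** A single value of a function is at most its Euclidean norm, and the initial
    function has norm at most 1 whatever the number of states: the sum over
    k is bounded by a constant, with no logarithm of the number of states. *)
Lemma delta_iter_le y k u : `|delta_iter y k u| <= rho ^+ k.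
Proof.
have e : \sum_u delta_iter y k u ^+ 2 <= (rho ^+ k) ^+ 2.
  elim: k => [|k IH]; first by rewrite expr0 expr1n; exact: sqr_centered_delta.
  apply: le_trans (contraction (delta_iter_mean_zero y k)) _.
  by rewrite [rho ^+ k.+1]exprS exprMn ler_wpM2l// sqr_ge0.
rewrite -ler_sqr ?nnegrE ?exprn_ge0// real_normK ?num_real//.
apply: le_trans e; rewrite (bigD1 u)//= lerDl sumr_ge0// => v _.
exact: sqr_ge0.
Qed.

Lemma geom_le k : \sum_(0 <= i < k) rho ^+ i <= (1 - rho)^-1.
Proof.
have r0 : 0 < 1 - rho by rewrite subr_gt0.
rewrite -[leRHS]mul1r ler_pdivlMr//.
have -> : (\sum_(0 <= i < k) rho ^+ i) * (1 - rho) = 1 - rho ^+ k.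
  elim: k => [|k IH]; first by rewrite big_geq// mul0r expr0 subrr.
  by rewrite big_nat_recr//= mulrDl IH exprS; ring.
by rewrite gerBl exprn_ge0.
Qed.

(** If G + T G solved the Poisson equation g - T g = 1_y - 1/N exactly, then
    - N (G + T G) would be the expected hitting time of y up to a constant.
    Truncating the series that defines G leaves an error rho ^ K, which costs
    only a factor 2 once rho ^ K <= 1 / (2 N); the shift by M makes the Lyapunov
    function V nonnegative. *)
Lemma contraction_hitting_time x (X : markov_chain Q x) y :
  (expected_hitting_time X y <= (8 * N / (1 - rho))%:E)%E.
Proof.
have N0 := cardR_gt0 y.
have r0 : 0 < 1 - rho by rewrite subr_gt0.
have [K rK] : exists K, rho ^+ K <= (2 * N)^-1.
  have := @cvg_expr _ rho; rewrite ger0_norm// => /(_ rho1) /cvgrPdist_le.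
  have N20 : 0 < (2 * N)^-1 by rewrite invr_gt0 mulr_gt0.
  move=> /(_ _ N20)[K _ /(_ K (leqnn K))/=].
  by rewrite sub0r normrN ger0_norm ?exprn_ge0// => h; exists K.
pose G u := \sum_(0 <= k < K) delta_iter y k u.
pose M := 2 / (1 - rho).
pose V u := 2 * N * (M - (G u + T G u)).
have GM u : `|G u| <= (1 - rho)^-1.
  apply: le_trans (ler_norm_sum _ _ _) _; apply: le_trans (geom_le K).
  by apply: ler_sum => k _; exact: delta_iter_le.
have TGM u : `|T G u| <= (1 - rho)^-1 by exact: transition_le.
have H u : `|G u + T G u| <= M.
  by apply: le_trans (ler_normD _ _) _; rewrite /M mulr_natl mulr2n lerD.
have NN0 : 0 <= 2 * N by rewrite mulr_ge0// ltW.
apply: (@le_trans _ _ (V x)%:E).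
  apply: expected_hitting_time_le => // [z|z zy].
    by rewrite /V mulr_ge0// subr_ge0; have := H z; rewrite ler_norml => /andP[].
  have -> : T V z = 2 * N * (M - (T G z + T (T G) z)) by exact: transition_affine.
  have -> : T (T G) z = G z + delta_iter y K z - delta_iter y 0 z.
    have -> : T (T G) z = \sum_(0 <= k < K) delta_iter y k.+1 z.
      rewrite -transition_sum; congr (T _ z); apply/funext => u.
      exact: transition_sum.
    have e : \sum_(0 <= k < K.+1) delta_iter y k z =
        delta_iter y 0 z + \sum_(0 <= k < K) delta_iter y k.+1 z.
      by rewrite big_nat_recl.
    have -> : G z + delta_iter y K z = \sum_(0 <= k < K.+1) delta_iter y k z.
      by rewrite big_nat_recr.
    by rewrite e addrAC subrr add0r.
  have := delta_iter_le y K z; rewrite ler_norml => /andP[+ _].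
  rewrite /V {2}/delta_iter/= {2}/centered_delta (negbTE zy).
  move=> h; have h2 : 2 * N * rho ^+ K <= 1.
    by rewrite mulrC -ler_pdivlMr ?mulr_gt0// mul1r.
  have h3 : 2 * N * - rho ^+ K <= 2 * N * delta_iter y K z by exact: ler_wpM2l.
  have h4 : N * N^-1 = 1 by rewrite divff// lt0r_neq0.
  move: h2 h3 h4; set g := G z; set tg := T G z; set i := N^-1.
  set p := delta_iter y K z; set r := rho ^+ K; move=> h2 h3 h4.
  have e : 2 * N * (M - (tg + (g + p - (0 - i)))) =
    2 * N * (M - (g + tg)) - 2 * N * p - 2 * (N * i) by ring.
  by rewrite e h4 mulr1; lra.
rewrite lee_fin.
have := H x; rewrite ler_norml => /andP[h _].
have -> : 8 * N / (1 - rho) = 2 * N * (M + M).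
  by rewrite /M; field; rewrite lt0r_neq0.
by rewrite /V ler_wpM2l// lerD2l; lra.
Qed.
End Contraction.

(** * Cheeger's inequality *)

(** c is the smallest value of g with at most half of the points strictly above
    it; the points strictly below c are those that are not above the previous
    value, which has more than half of the points above it. *)
Lemma median (R : realFieldType) (S : finType) (g : S -> R) :
  (0 < #|S|)%N -> exists c,
    (#|[set x | (c < g x)%R]|.*2 <= #|S|)%N /\
    (#|[set x | (g x < c)%R]|.*2 <= #|S|)%N.
Proof.
move=> /card_gt0P[x0 _].
pose P x := (#|[set y | (g x < g y)%R]|.*2 <= #|S|)%N.
have [m _ mmax] := @arg_maxP _ _ _ x0 predT g isT.
have {}mmax y : g y <= g m by exact: mmax.
have Pm : P m by rewrite /P eq_card0// => y; rewrite !inE ltNge mmax.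
have [x Px xmin] := @arg_minP _ _ _ m P g Pm.
exists (g x); split=> //; set B := [set y | (g y < g x)%R].
have [->|[z0 Bz0]] := set_0Vmem B; first by rewrite cards0.
have [z Bz zmax] := @arg_maxP _ _ _ z0 (mem B) g Bz0.
have {}zmax y : g y < g x -> g y <= g z.
  by move=> yx; have : y \in B by [rewrite inE]; exact: zmax.
have zx : g z < g x by have : z \in B := Bz; rewrite inE.
have : ~~ P z by apply/negP => /xmin; rewrite leNgt zx.
rewrite /P -ltnNge (_ : [set y | _] = ~: B).
  by have := cardsC B; rewrite -!muln2; lia.
apply/setP => y; rewrite !inE -leNgt; apply/idP/idP => [zy|].
  by rewrite leNgt; apply/negP => yx; move: zy; rewrite ltNge zmax.
exact: lt_le_trans.
Qed.

Lemma max0_ge0 (R : realFieldType) (x : R) : 0 <= Num.max x 0.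
Proof. by have [|/ltW] := leP x 0. Qed.

Lemma max0_gt0 (R : realFieldType) (x : R) : (0 < Num.max x 0) = (0 < x).
Proof. by have [x0|] := leP x 0; rewrite ?ltxx// ltNge x0. Qed.

Lemma pos_neg_parts_sqr (R : realFieldType) (p q : R) :
  (Num.max p 0 - Num.max q 0) ^+ 2 + (Num.max (- p) 0 - Num.max (- q) 0) ^+ 2
    <= (p - q) ^+ 2.
Proof.
have parts (x : R) : [/\ 0 <= Num.max x 0, 0 <= Num.max (- x) 0,
    x = Num.max x 0 - Num.max (- x) 0 & Num.max x 0 * Num.max (- x) 0 = 0].
  have [x0|x0] := leP x 0.
    by rewrite max_l ?oppr_ge0// sub0r opprK mul0r.
  by rewrite max_r ?subr0 ?mulr0 ?lexx ?(ltW x0)// oppr_le0 ltW.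
have [] := parts p; have [] := parts q.
set P := Num.max p 0; set P' := Num.max (- p) 0.
set Q := Num.max q 0; set Q' := Num.max (- q) 0.
move=> Q0 Q'0 -> QQ P0 P'0 -> PP.
have h1 := mulr_ge0 P0 Q'0; have h2 := mulr_ge0 Q0 P'0.
have -> : (P - P' - (Q - Q')) ^+ 2 = (P - Q) ^+ 2 + (P' - Q') ^+ 2
  + 2 * (P * Q' + Q * P') - 2 * (P * P') - 2 * (Q * Q') by ring.
by rewrite PP QQ; lra.
Qed.

(** A multigraph is given by the end points a and b of its edges. Its isoperimetric
    constant is at least h, and summing a function over the end points of all
    edges counts every vertex d times, that is, the graph is d-regular. *)
Section Cheeger.
Variables (R : realFieldType) (S E : finType) (a b : E -> S) (h d : R).
Hypothesis h0 : 0 < h.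
Hypothesis d0 : 0 < d.
Hypothesis degree : forall f : S -> R,
  \sum_e (f (a e) + f (b e)) = d * \sum_u f u.
Hypothesis isoperimetry : forall A : {set S}, (#|A|.*2 <= #|S|)%N ->
  h * #|A|%:R <= #|[set e | (a e \in A) != (b e \in A)]|%:R.

(** The discrete coarea formula: peel off w the layer w x * 1_A, where A is the
    support of w and w x its least value on A. The variation drops by w x times
    the boundary of A, the sum by w x times the size of A, and the support of
    what remains is smaller. *)
Lemma coarea (w : S -> R) : (forall u, 0 <= w u) ->
    (#|[set u | (0 < w u)%R]|.*2 <= #|S|)%N ->
  h * \sum_u w u <= \sum_e `|w (a e) - w (b e)|.
Proof.
move: {2}#|_| (leqnn #|[set u | (0 < w u)%R]|) => n.
elim: n w => [|n IH] w wn w0 wS.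
  have {}w0 u : w u = 0.
    apply/eqP; rewrite -[_ == _]negbK; apply/negP => wu.
    move: wn; rewrite leqn0 cards_eq0 => /eqP/setP/(_ u).
    by rewrite !inE lt_def wu w0.
  by rewrite big1 // mulr0 sumr_ge0.
set A := [set u | (0 < w u)%R] in wn wS.
have [A0|[x0 Ax0]] := set_0Vmem A.
  by apply: IH => //; rewrite -/A A0 cards0.
have [x Ax xmin] := @arg_minP _ _ _ x0 (mem A) w Ax0.
pose w' u := w u - w x * (u \in A)%:R.
have w'0 u : 0 <= w' u.
  rewrite /w'; case: (boolP (u \in A)) => uA; rewrite ?mulr0 ?subr0//.
  rewrite mulr1 subr_ge0.
  exact: xmin.
have memA u : (u \in A) = (0 < w u) by rewrite inE.
have wx : 0 < w x by rewrite -memA.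
have sub : [set u | (0 < w' u)%R] \subset A :\ x.
  apply/fintype.subsetP => u; rewrite in_setD1 inE /w'.
  case: (boolP (u \in A)) => uA; last by rewrite mulr0 subr0 -memA (negbTE uA).
  rewrite andbT => wu.
  by apply/negP => /eqP e; move: wu; rewrite e mulr1 subrr ltxx.
have cA : #|A| = #|A :\ x|.+1 by rewrite (cardsD1 x A) memA wx.
have cw' := subset_leq_card sub.
have /IH H : (#|[set u | (0 < w' u)%R]| <= n)%N.
  by apply: leq_trans cw' _; rewrite -ltnS -cA.
have {}H : h * \sum_u w' u <= \sum_e `|w' (a e) - w' (b e)|.
  apply: H => //; apply: leq_trans wS.
  by rewrite leq_double (leq_trans cw')// cA.
have -> : \sum_u w u = \sum_u w' u + w x * #|A|%:R.
  rewrite /w' sumrB -mulr_sumr -natr_sum.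
  rewrite (eq_bigr (fun u => nat_of_bool (u \in A)))// -big_mkcond.
  by rewrite sum1_card subrK.
have -> : \sum_e `|w (a e) - w (b e)| = \sum_e `|w' (a e) - w' (b e)| +
   w x * #|[set e | (a e \in A) != (b e \in A)]|%:R.
  rewrite -sum1_card natr_sum [X in w x * X]big_mkcond/= mulr_sumr -big_split/=.
  apply: eq_bigr => e _; rewrite inE.
  have := w'0 (a e); have := w'0 (b e); rewrite /w'.
  have wA u : u \notin A -> w u = 0.
    by rewrite memA -leNgt => wu; apply/eqP; rewrite eq_le w0 wu.
  case: (boolP (a e \in A)) => aA; case: (boolP (b e \in A)) => bA //=;
    rewrite ?(wA _ aA) ?(wA _ bA) ?mulr1 ?mulr0 ?subr0 ?addr0 ?sub0r//.
  - by move=> _ _; congr `|_|; ring.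
  - by move=> _ h1; rewrite !ger0_norm// ?subrK.
  - by move=> h1 _; rewrite !normrN !ger0_norm// ?subrK.
by rewrite mulrDr lerD// mulrCA ler_wpM2l ?isoperimetry// ltW.
Qed.

(** The coarea formula is applied to u ^ 2. The Cauchy-Schwarz inequality for
    |p^2 - q^2| = |p - q| (p + q) is used as a weighted arithmetic-geometric
    inequality, with the weight for which half of h * sum u^2 is absorbed by the
    left-hand side. *)
Lemma cheeger_nonneg (u : S -> R) : (forall x, 0 <= u x) ->
    (#|[set x | (0 < u x)%R]|.*2 <= #|S|)%N ->
  h ^+ 2 / (2 * d) * \sum_x u x ^+ 2 <= \sum_e (u (a e) - u (b e)) ^+ 2.
Proof.
move=> u0 uS; set U := \sum_x _; set D := \sum_e _.
have hU : h * U <= \sum_e `|u (a e) ^+ 2 - u (b e) ^+ 2|.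
  apply: coarea => [x|]; first exact: sqr_ge0.
  rewrite (_ : [set x | _] = [set x | (0 < u x)%R])//.
  by apply/setP => x; rewrite !inE !lt_def sqrf_eq0 u0 sqr_ge0.
have pt e : `|u (a e) ^+ 2 - u (b e) ^+ 2| <= d / h * (u (a e) - u (b e)) ^+ 2 +
    h / (2 * d) * (u (a e) ^+ 2 + u (b e) ^+ 2).
  set p := u (a e); set q := u (b e); pose k := h / (2 * d); pose s := d / h.
  have s0 : 0 < s by rewrite divr_gt0.
  have k0 : 0 < k by rewrite divr_gt0// mulr_gt0.
  have sk : 2 * s * k = 1 by rewrite /s /k; field; rewrite !lt0r_neq0.
  rewrite -/k -/s subr_sqr normrM (ger0_norm (addr_ge0 (u0 _) (u0 _))).
  have -> : (p - q) ^+ 2 = `|p - q| ^+ 2 by rewrite real_normK ?num_real.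
  rewrite -/p -/q; set X := `|p - q|.
  have h1 : 0 <= s * (X - k * (p + q)) ^+ 2 by rewrite mulr_ge0 ?sqr_ge0// ltW.
  have h2 : 0 <= k * (p - q) ^+ 2 by rewrite mulr_ge0 ?sqr_ge0// ltW.
  have e1 : s * (X - k * (p + q)) ^+ 2 = s * X ^+ 2 -
      (2 * s * k) * (X * (p + q)) + (2 * s * k) * (k * (p + q) ^+ 2 / 2) by field.
  rewrite e1 sk !mul1r in h1.
  have e2 : k * (p ^+ 2 + q ^+ 2) =
      k * (p + q) ^+ 2 / 2 + k * (p - q) ^+ 2 / 2 by field.
  by rewrite e2; lra.
have : h * U <= d / h * D + h / (2 * d) * (d * U).
  apply: le_trans hU _; rewrite -(degree (fun x => u x ^+ 2)).
  rewrite !mulr_sumr -big_split/=.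
  exact: ler_sum.
have -> : h / (2 * d) * (d * U) = h * U / 2 by field; rewrite lt0r_neq0.
move=> H; have {}H : h * U / 2 <= d / h * D by lra.
rewrite -(@ler_pM2l _ (d / h)) ?divr_gt0//; apply: le_trans H.
by rewrite le_eqVlt; apply/orP; left; apply/eqP; field; rewrite !lt0r_neq0.
Qed.

(** Subtracting a median c gives a positive and a negative part that are each
    supported on at most half of the vertices; the energies of the two parts add
    up to at most that of g, and the mean zero function g is closer to 0 than
    to c in mean square. *)
Lemma cheeger (g : S -> R) : \sum_x g x = 0 ->
  h ^+ 2 / (2 * d) * \sum_x g x ^+ 2 <= \sum_e (g (a e) - g (b e)) ^+ 2.
Proof.
move=> g0; have [S0|S0] := posnP #|S|.
  rewrite [X in _ * X]big1 ?mulr0 ?sumr_ge0// => [e _|x]; first exact: sqr_ge0.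
  by have := card0_eq S0 x; rewrite !inE.
have [c [up down]] := median g S0.
pose u x := Num.max (g x - c) 0; pose v x := Num.max (c - g x) 0.
have u0 x : 0 <= u x by exact: max0_ge0.
have v0 x : 0 <= v x by exact: max0_ge0.
have /cheeger_nonneg - /(_ u0) hu : (#|[set x | (0 < u x)%R]|.*2 <= #|S|)%N.
  rewrite (_ : [set x | _] = [set x | (c < g x)%R])//.
  by apply/setP => x; rewrite !inE max0_gt0 subr_gt0.
have /cheeger_nonneg - /(_ v0) hv : (#|[set x | (0 < v x)%R]|.*2 <= #|S|)%N.
  rewrite (_ : [set x | _] = [set x | (g x < c)%R])//.
  by apply/setP => x; rewrite !inE max0_gt0 subr_gt0.
have k0 : 0 <= h ^+ 2 / (2 * d) by rewrite divr_ge0 ?sqr_ge0// mulr_ge0// ltW.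
apply: (@le_trans _ _ (h ^+ 2 / (2 * d) * \sum_x (u x ^+ 2 + v x ^+ 2))).
  rewrite ler_wpM2l//.
  have -> : \sum_x (u x ^+ 2 + v x ^+ 2) =
      \sum_x g x ^+ 2 - 2 * c * \sum_x g x + \sum_(x : S) c ^+ 2.
    rewrite mulr_sumr -sumrB -big_split/=; apply: eq_bigr => x _.
    rewrite /u /v; case: (lerP (g x) c) => gc;
      [rewrite max_r ?max_l|rewrite max_l ?max_r];
      by rewrite ?subr_le0 ?subr_ge0 ?(ltW gc)//; ring.
  by rewrite g0 mulr0 subr0 lerDl sumr_ge0// => x _; exact: sqr_ge0.
rewrite big_split/= mulrDr; apply: le_trans (lerD hu hv) _.
rewrite -big_split/=; apply: ler_sum => e _; rewrite /u /v.
have := pos_neg_parts_sqr (g (a e) - c) (g (b e) - c).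
by rewrite !opprB subrKA.
Qed.
End Cheeger.

(** * From expansion to contraction of the permuted averaging operator *)

(** The vertices have two neighbours l x and r x, and being a neighbour is a
    symmetric relation, with multiplicities. *)
Section Averaging.
Variables (R : realFieldType) (S : finType) (l r : S -> S).
Hypothesis nbr_sym : forall f g : S -> R,
  \sum_x (f (l x) + f (r x)) * g x = \sum_x f x * (g (l x) + g (r x)).

Definition avg (f : S -> R) (x : S) : R := (f (l x) + f (r x)) / 2.

Definition variation (f : S -> R) : R := \sum_x (f (l x) - f (r x)) ^+ 2.

Lemma nbr_sum (f : S -> R) : \sum_x (f (l x) + f (r x)) = 2 * \sum_x f x.
Proof.
have := nbr_sym f (fun=> 1); under eq_bigr do rewrite mulr1.
by move=> ->; rewrite mulr_sumr; apply: eq_bigr => x _; rewrite mulrC.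
Qed.

Lemma sum_avg (f : S -> R) : \sum_x avg f x = \sum_x f x.
Proof. by rewrite -mulr_suml nbr_sum; field. Qed.

Lemma avg_adj (f g : S -> R) : \sum_x avg f x * g x = \sum_x f x * avg g x.
Proof.
rewrite /avg; under eq_bigr do rewrite mulrAC.
by rewrite -mulr_suml nbr_sym mulr_suml; apply: eq_bigr => x _; rewrite mulrA.
Qed.

Lemma sqr_avg (f : S -> R) :
  \sum_x avg f x ^+ 2 = \sum_x f x ^+ 2 - variation f / 4.
Proof.
have := nbr_sum (fun x => f x ^+ 2) => e.
have -> : \sum_x f x ^+ 2 = (\sum_x (f (l x) ^+ 2 + f (r x) ^+ 2)) / 2.
  by rewrite e; field.
rewrite /variation !mulr_suml -sumrB; apply: eq_bigr => x _.
by rewrite /avg; field.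
Qed.

(** By self-adjointness this says that |f|^2 - 2 <f, avg^2 f> + |avg^2 f|^2 is
    nonnegative. *)
Lemma variation_avg (f : S -> R) : variation (avg f) <= variation f.
Proof.
have h1 := sqr_avg f; have h2 := sqr_avg (avg f).
have h3 : 0 <= \sum_x (f x - avg (avg f) x) ^+ 2.
  by apply: sumr_ge0 => x _; exact: sqr_ge0.
have h4 : \sum_x (f x - avg (avg f) x) ^+ 2 = \sum_x f x ^+ 2
    - 2 * \sum_x f x * avg (avg f) x + \sum_x avg (avg f) x ^+ 2.
  by rewrite mulr_sumr -sumrB -big_split/=; apply: eq_bigr => x _; ring.
have h5 : \sum_x f x * avg (avg f) x = \sum_x avg f x ^+ 2.
  by rewrite -avg_adj; apply: eq_bigr => x _; rewrite expr2.
by move: h1 h2 h3 h4 h5; lra.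
Qed.

Variable sigma : {perm S}.

Lemma sum_perm (f : S -> R) : \sum_x f (sigma x) = \sum_x f x.
Proof. by rewrite [RHS](reindex_inj (@perm_inj _ sigma)). Qed.

(** Averaging alone does not contract: slowly varying functions lose almost
    nothing. Over two steps, with h = f o sigma and g = avg h, the square norm
    drops by a quarter of the variation of h, which is at least that of g, and
    then by a quarter of the variation of g o sigma. By the gap inequality the two
    losses cannot both be small compared to |g|^2; and if |g|^2 is itself small,
    the first step has already contracted. *)
Lemma avg_perm_contraction (gamma : R) (f : S -> R) : 0 <= gamma ->
    (forall g : S -> R, \sum_x g x = 0 ->
      gamma * \sum_x g x ^+ 2 <= variation g + variation (g \o sigma)) ->
    \sum_x f x = 0 ->
  (1 + gamma / 4) * \sum_x avg (avg (f \o sigma) \o sigma) x ^+ 2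
    <= \sum_x f x ^+ 2.
Proof.
move=> gamma0 gap f0; set h := f \o sigma; set g := avg h.
have g0 : \sum_x g x = 0 by rewrite sum_avg; exact: etrans (sum_perm f) f0.
have hf : \sum_x h x ^+ 2 = \sum_x f x ^+ 2.
  exact: (sum_perm (fun x => f x ^+ 2)).
have gs : \sum_x (g \o sigma) x ^+ 2 = \sum_x g x ^+ 2.
  exact: (sum_perm (fun x => g x ^+ 2)).
have := gap g g0; have := variation_avg h; have := sqr_avg h.
have := sqr_avg (g \o sigma); rewrite -/g gs hf.
have v0 : 0 <= variation (g \o sigma).
  by apply: sumr_ge0 => x _; exact: sqr_ge0.
set B := \sum_x avg _ _ ^+ 2; move=> e1 e2 v1 v2.
have Bg : B <= \sum_x g x ^+ 2 by lra.
have : gamma * B <= gamma * \sum_x g x ^+ 2 by apply: ler_wpM2l.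
by lra.
Qed.

Definition bdry (A : {set S}) : {set S} := [set x | (l x \in A) != (r x \in A)].

(** Expansion of the union of the graph and of its image under sigma. The
    quotient is rounded down, so that for a set of fewer than 32
    elements a single boundary edge suffices. *)
Definition expander :=
  forall A : {set S}, (0 < #|A|)%N -> (#|A|.*2 <= #|S|)%N ->
    (#|A| %/ 32 < #|bdry A| + #|bdry (sigma @^-1: A)|)%N.

Lemma expander_gap (g : S -> R) : expander -> \sum_x g x = 0 ->
  2 ^- 13 * \sum_x g x ^+ 2 <= variation g + variation (g \o sigma).
Proof.
move=> exp g0.
pose a (e : bool * S) := if e.1 then sigma (l e.2) else l e.2.
pose b (e : bool * S) := if e.1 then sigma (r e.2) else r e.2.
have pairE (F : bool * S -> R) :
    \sum_e F e = \sum_x F (false, x) + \sum_x F (true, x).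
  rewrite (eq_bigr (fun e => F (e.1, e.2))) => [|[]//].
  by rewrite -(pair_bigA _ (fun i j => F (i, j)))/= big_bool addrC.
have pairE' (F : bool * S -> nat) :
    (\sum_e F e = \sum_x F (false, x) + \sum_x F (true, x))%N.
  rewrite (eq_bigr (fun e => F (e.1, e.2))) => [|[]//].
  by rewrite -(pair_bigA _ (fun i j => F (i, j)))/= big_bool addnC.
have -> : variation g + variation (g \o sigma) = \sum_e (g (a e) - g (b e)) ^+ 2.
  by rewrite pairE.
have -> : 2 ^- 13 = (32^-1) ^+ 2 / (2 * 4) :> R by field.
(* Each vertex has two neighbours in each of the two graphs: d = 4. *)
apply: cheeger => // [f|A].
  rewrite pairE/= nbr_sum.
  have -> := nbr_sum (f \o sigma).
  by rewrite (sum_perm f); ring.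
have [->|A0 AS] := posnP #|A|; first by rewrite mulr0.
have := exp A A0 AS.
have -> : #|[set e | (a e \in A) != (b e \in A)]| =
    (#|bdry A| + #|bdry (sigma @^-1: A)|)%N.
  rewrite -!sum1_card big_mkcond/= pairE'/=.
  congr (_ + _)%N; rewrite [RHS]big_mkcond;
    by apply: eq_bigr => x _; rewrite !inE.
move=> h; rewrite mulrC ler_pdivrMr// -natrM ler_nat.
by move: (divn_eq #|A| 32) (ltn_pmod #|A| (isT : 0 < 32)%N) h; lia.
Qed.
End Averaging.

Lemma sum_nbr_sym (R : realFieldType) (m : nat) (F : nat -> nat -> R) :
  \sum_(0 <= i < m.+1) (F i.-1 i + F (minn i.+1 m) i) =
  \sum_(0 <= i < m.+1) (F i i.-1 + F i (minn i.+1 m)).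
Proof.
rewrite !big_split/=.
have lo (G : nat -> nat -> R) : \sum_(0 <= i < m.+1) G i.-1 i =
    G 0%N 0%N + \sum_(0 <= i < m) G i i.+1.
  by rewrite big_nat_recl.
have hi (G : nat -> nat -> R) : \sum_(0 <= i < m.+1) G (minn i.+1 m) i =
    \sum_(0 <= i < m) G i.+1 i + G m m.
  rewrite big_nat_recr//= (minn_idPr (leqnSn m)); congr (_ + _).
  by apply: eq_big_nat => i /andP[_ im]; rewrite (minn_idPl im).
by rewrite lo hi (lo (fun i j => F j i)) (hi (fun i j => F j i)); ring.
Qed.

Lemma segment_nbr_sym (R : realFieldType) (n : nat) (f g : seg n -> R) :
  \sum_x (f (left_nbr x) + f (right_nbr x)) * g x =
  \sum_x f x * (g (left_nbr x) + g (right_nbr x)).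
Proof.
have := sum_nbr_sym n.*2 (fun i j => f (inord i) * g (inord j)).
rewrite !big_mkord.
under eq_bigr => i _ do rewrite inord_val -mulrDl.
by under [in RHS]eq_bigr => i _ do rewrite inord_val -mulrDr.
Qed.

Lemma permuted_walk_transition (R : realType) n (sigma : {perm seg n})
    (f : seg n -> R) :
  transition (permuted_walk R sigma) f =
    avg (@left_nbr n) (@right_nbr n) (f \o sigma).
Proof.
apply/funext => x; rewrite /transition /permuted_walk /avg/=.
have pick y : \sum_z (z == y)%:R / 2 * f z = f y / 2.
  rewrite (bigD1 y)//= eqxx big1 ?addr0 => [|z /negbTE ->]; last by rewrite !mul0r.
  by rewrite mul1r mulrC.
under eq_bigr do rewrite mulrDl.
by rewrite big_split/= !pick mulrDl.
Qed.

(** The gap 2^-13 makes two steps of the walk contract the square norm by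
    1 / (1 + 2^-15), which is at most the square of rho = 1 - 2^-17. *)
Lemma expander_hitting_time (R : realType) n (sigma : {perm seg n})
    x (X : markov_chain (permuted_walk R sigma) x) y :
  expander (@left_nbr n) (@right_nbr n) sigma ->
  (expected_hitting_time X y <= (2 ^+ 20 * n.*2.+1%:R)%:E)%E.
Proof.
move=> exp; pose rho : R := 1 - 2 ^- 17.
have -> : 2 ^+ 20 * n.*2.+1%:R = 8 * #|{: seg n}|%:R / (1 - rho) :> R.
  by rewrite card_ord /rho; field.
have sym := @segment_nbr_sym R n.
apply: contraction_hitting_time.
- by move=> u v; rewrite addr_ge0 ?divr_ge0.
- move=> u; have := congr1 (@^~ u) (permuted_walk_transition sigma (fun=> 1 : R)).
  rewrite /transition /avg/=; under eq_bigr do rewrite mulr1.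
  by move=> ->; field.
- have : 2 ^- 17 <= 1 :> R by rewrite invf_le1 ?exprn_gt0// exprn_ege1// ler1n.
  by rewrite /rho subr_ge0.
- by rewrite /rho gtrBl invr_gt0 exprn_gt0.
- move=> f f0; rewrite !permuted_walk_transition (sum_avg sym) (sum_perm sigma).
  by rewrite (sum_avg sym) (sum_perm sigma).
move=> f f0; rewrite !permuted_walk_transition.
have g0 : 0 <= 2 ^- 13 :> R by rewrite invr_ge0 exprn_ge0.
have := avg_perm_contraction sym g0 (fun g => expander_gap sym exp (g := g)) f0.
set B := \sum_x _; set F := \sum_x _; move=> H.
have B0 : 0 <= B by apply: sumr_ge0 => x' _; exact: sqr_ge0.
apply: (@le_trans _ _ (rho ^+ 2 * ((1 + 2 ^- 13 / 4) * B))); last first.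
  by rewrite ler_wpM2l// sqr_ge0.
rewrite mulrA ler_peMl//.
have -> : 2 ^- 13 / 4 = 4 * 2 ^- 17 :> R by field.
rewrite /rho; set t : R := 2 ^- 17.
have t0 : 0 <= t by rewrite invr_ge0 exprn_ge0.
have t1 : t <= 2^-1 ^+ 2.
  by rewrite /t exprVn lef_pV2 ?posrE ?exprn_gt0// ler_weXn2l// ler1n.
by nra.
Qed.

(** * Most permutations are expanding *)

(** A set of at most k elements contributes at least x ^ k to the expansion of
    (1 + x) ^ #|S| over all subsets. *)
Lemma card_small_sets (R : realFieldType) (S : finType) (x : R) k : 0 <= x <= 1 ->
  #|[set D : {set S} | (#|D| <= k)%N]|%:R * x ^+ k <= (1 + x) ^+ #|S|.
Proof.
move=> /andP[x0 x1].
have -> : (1 + x) ^+ #|S| = \sum_(D : {set S}) x ^+ #|D|.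
  have := @bigA_distr R 0 1 *%R +%R S (fun=> x) (fun=> 1).
  rewrite prodr_const addrC => ->; apply: eq_bigr => D _.
  by rewrite -big_mkcond prodr_const.
rewrite -sum1_card natr_sum mulr_suml big_mkcond; apply: ler_sum => D _.
rewrite inE; case: ifP => Dk; last exact: exprn_ge0.
by rewrite mul1r ler_wiXn2l.
Qed.

Lemma leq_bin_pow N a : (a <= N -> N ^ a <= 'C(N, a) * a ^ a)%N.
Proof.
elim: a N => [|a IH] [|N] //.
rewrite ltnS => aN; have [a0|a0] := posnP a.
  by rewrite a0 bin1 expn1 muln1.
have := IH _ aN => H.
have e : ('C(N.+1, a.+1) * a.+1 = N.+1 * 'C(N, a))%N by rewrite mulnC -mul_bin_diag.
rewrite [(a.+1 ^ _)%N]expnS mulnA e [X in (X <= _)%N]expnS -mulnA leq_pmul2l//.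
rewrite -(@leq_pmul2r (a ^ a)) ?expn_gt0 ?a0//.
(* The step amounts to (N + 1) / (a + 1) <= N / a. *)
apply: (@leq_trans ((N * a.+1) ^ a)%N).
  by rewrite -expnMn leq_exp2r// mulSn mulnS leq_add2r.
by rewrite expnMn mulnAC leq_mul.
Qed.

(** List both sets followed by their complements, and match the lists. *)
Lemma perm_preimset (S : finType) (A B : {set S}) : #|A| = #|B| ->
  exists tau : {perm S}, tau @^-1: A = B.
Proof.
move=> cAB.
pose s (A : {set S}) := enum A ++ enum (~: A).
have us (C : {set S}) : uniq (s C).
  rewrite cat_uniq !enum_uniq andbT/=; apply/hasPn => x.
  by rewrite !mem_enum inE.
have ms (C : {set S}) x : x \in s C by rewrite mem_cat !mem_enum inE orbN.
have zs (C : {set S}) : size (s C) = #|S| by rewrite size_cat -!cardE cardsC.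
pose t x := nth x (s A) (index x (s B)).
have lt x : (index x (s B) < size (s A))%N by rewrite zs -(zs B) index_mem.
have t_inj : injective t.
  move=> x y; rewrite /t (set_nth_default x y)// => /eqP.
  rewrite nth_uniq// => /eqP e.
  by rewrite -(nth_index x (ms B x)) e nth_index.
exists (perm t_inj); apply/setP => x; rewrite inE permE /t nth_cat.
have -> : (index x (s B) < size (enum A))%N = (x \in B).
  rewrite -cardE cAB index_cat mem_enum; case: ifP => xB.
    by rewrite cardE index_mem mem_enum.
  by rewrite -cardE ltnNge leq_addr.
have := lt x; rewrite size_cat index_cat mem_enum; case: ifP => xB lx.
  by rewrite -mem_enum mem_nth// -cardE cAB cardE index_mem mem_enum.
apply/negbTE; rewrite -finset.in_setC -mem_enum mem_nth//.
rewrite -cardE cAB -cardE addKn.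
move: lx; rewrite -!cardE cAB ltn_add2l => lx.
exact: lx.
Qed.

(** The preimage of A under a uniform permutation is uniform among the sets of
    the size of A. Composing with a permutation that maps A to C shows that the
    event for A is at most as likely as the event for C, and the events for
    different C of the same size are disjoint. *)
Lemma card_perm_preimset (S : finType) (A B : {set S}) :
  (#|[set sigma : {perm S} | sigma @^-1: A == B]| * 'C(#|S|, #|A|)
    <= #|{: {perm S}}|)%N.
Proof.
rewrite mulnC -card_draws -sum_nat_const.
pose F (C : {set S}) := [set sigma : {perm S} | sigma @^-1: C == B].
apply: (@leq_trans (\sum_(C in [set C : {set S} | #|C| == #|A|]) #|F C|)%N).
  apply: leq_sum => C; rewrite inE => /eqP cC.
  have [tau tauC] := perm_preimset (esym cC).
  rewrite -(card_imset _ (mulIg tau^-1)%g).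
  apply: subset_leq_card; apply/fintype.subsetP => _ /imsetP[s + ->].
  rewrite !inE => /eqP <-; apply/eqP/setP => x; rewrite !inE -tauC inE.
  by rewrite permM permKV.
under eq_bigr => C _ do rewrite -sum1_card.
rewrite (exchange_big_dep xpredT)//= -[leqRHS]sum1_card; apply: leq_sum => s _.
rewrite sum1dep_card; apply/card_le1_eqP => C D; rewrite !inE.
move=> /andP[_ /eqP sC] /andP[_ /eqP sD]; apply/setP => x.
by have /setP/(_ (s^-1%g x)) := etrans sC (esym sD); rewrite !inE permKV.
Qed.

(** On a connected graph, the boundary of a set and the knowledge whether one given
    vertex belongs to it determine the set. *)
Section Counting.
Variables (S : finType) (l r : S -> S) (root : S).
Hypothesis bdry_inj : forall A B : {set S},
  bdry l r A = bdry l r B -> (root \in A) = (root \in B) -> A = B.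
Local Notation bdry := (bdry l r).
Local Notation N := #|S|.

Definition small_bdry a k := [set A : {set S} | (#|A| == a) && (#|bdry A| <= k)%N].

Lemma bdry_gt0 (A : {set S}) : (0 < #|A| < N)%N -> (0 < #|bdry A|)%N.
Proof.
move=> /andP[A0 AN]; rewrite lt0n; apply/negP => /eqP/cards0_eq bA.
have b0 : bdry finset.set0 = finset.set0 by apply/setP => x; rewrite !inE.
have bT : bdry [set: S] = finset.set0 by apply/setP => x; rewrite !inE.
case: (boolP (root \in A)) => rA.
  have e : A = [set: S].
    by apply: bdry_inj; [rewrite bA bT|rewrite inE rA].
  by move: AN; rewrite e cardsT ltnn.
have e : A = finset.set0.
  by apply: bdry_inj; [rewrite bA b0|rewrite inE (negbTE rA)].
by move: A0; rewrite e cards0.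
Qed.

Lemma card_small_bdry a k :
  (#|small_bdry a k| <= 2 * #|[set D : {set S} | (#|D| <= k)%N]|)%N.
Proof.
pose code (A : {set S}) := (root \in A, bdry A).
have code_inj : injective code by move=> A B [rAB bAB]; exact: bdry_inj.
rewrite -(card_imset _ code_inj) -card_bool -cardsT -cardsX.
apply: subset_leq_card; apply/fintype.subsetP => _ /imsetP[A + ->].
by rewrite !inE => /andP[_].
Qed.

Definition bad_at a : {set {perm S}} :=
  [set sigma : {perm S} | [exists A : {set S}, (#|A| == a) &&
    (#|bdry A| + #|bdry (sigma @^-1: A)| <= a %/ 32)%N]].

(** Union bound over the pairs (A, B) such that sigma maps B to A: both sets have a
    small boundary. *)
Lemma card_bad_at a :
  (#|bad_at a| * 'C(N, a)
    <= #|small_bdry a (a %/ 32)| ^ 2 * #|{: {perm S}}|)%N.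
Proof.
set P := small_bdry _ _.
have sub : bad_at a \subset \bigcup_(AB in finset.setX P P)
    [set sigma : {perm S} | sigma @^-1: AB.1 == AB.2].
  apply/fintype.subsetP => s; rewrite inE => /fintype.existsP[A /andP[cA bA]].
  apply/finset.bigcupP; exists (A, s @^-1: A); last by rewrite inE.
  rewrite !inE/= cA card_preimset; last exact: perm_inj.
  rewrite cA (leq_trans (leq_addr _ _) bA).
  by rewrite (leq_trans (leq_addl _ _) bA).
apply: (@leq_trans (\sum_(AB in finset.setX P P)
    #|[set sigma : {perm S} | sigma @^-1: AB.1 == AB.2]| * 'C(N, a))%N).
  rewrite -big_distrl/= leq_mul2r; apply/orP; right.
  apply: leq_trans (subset_leq_card sub) _.
  apply: (big_ind2 (fun (X : {set {perm S}}) n => #|X| <= n)%N) => //.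
    by rewrite cards0.
  by move=> X m Y n Xm Yn; apply: leq_trans (leq_card_setU X Y) (leq_add Xm Yn).
rewrite expnS expn1 -cardsX -sum_nat_const; apply: leq_sum => -[A B].
rewrite !inE/= => /andP[/andP[/eqP <- _] _].
exact: card_perm_preimset.
Qed.

(** A set which is neither empty nor full has a nonempty boundary in both graphs,
    so a failure needs a bound of at least 2 on the total boundary. *)
Lemma bad_at0 a : (0 < a)%N -> (a.*2 <= N)%N -> (a %/ 32 < 2)%N ->
  bad_at a = finset.set0.
Proof.
move=> a0 aN k2; apply/setP => s; rewrite inE [RHS]inE.
apply/negbTE/negP => h.
case/fintype.existsP: h => A /andP[/eqP cA bA].
have aN' : (0 < a < N)%N by rewrite a0 (leq_trans _ aN)// -addnn -addn1 leq_add2l.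
have h1 := @bdry_gt0 A; have h2 := @bdry_gt0 (s @^-1: A).
rewrite card_preimset in h2; last exact: perm_inj.
rewrite cA in h1 h2; have := h1 aN'; have := h2 aN'.
by lia.
Qed.

(** With k = a / 32 rounded down and y = a / N <= 1/2, there are at most 2 D sets
    with boundary at most k, where D <= (2^9 / y) ^ k, whereas the number of sets
    of size a is at least y ^ (- 32 k). The probability of failure is therefore at
    most 4 * 2 ^ (18 k) * y ^ (30 k). As k >= 2, a factor y ^ 2 = a ^ 2 / N ^ 2 can
    be set aside; the remaining powers of y, each at most 1/2, beat both
    2 ^ (18 k) and a ^ 2. The factor 1 / N ^ 2 pays for the union over a. *)
Lemma card_bad_at_le (R : realType) a : (0 < a)%N -> (a.*2 <= N)%N ->
  #|bad_at a|%:R * N%:R ^+ 2 <= 2 ^+ 14 * #|{: {perm S}}|%:R :> R.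
Proof.
move=> a0 aN; have [k2|k2] := ltnP (a %/ 32) 2.
  by rewrite bad_at0// cards0 mul0r mulr_ge0// exprn_ge0.
set k := (a %/ 32)%N in k2.
have N0 : (0 < N)%N by lia.
have NR : 0 < N%:R :> R by rewrite ltr0n.
have NR0 : N%:R != 0 :> R by rewrite lt0r_neq0.
set D := #|[set D : {set S} | (#|D| <= k)%N]|.
pose y : R := a%:R / N%:R.
have y0 : 0 < y by rewrite divr_gt0 ?ltr0n.
have y12 : y <= 2^-1.
  by rewrite ler_pdivrMr// ler_pdivlMl// -natrM ler_nat mul2n.
have y1 : y <= 1 by lra.
have ka : (32 * k <= a < 32 * k.+1)%N.
  by have := divn_eq a 32; have := ltn_pmod a (isT : 0 < 32)%N; rewrite -/k; lia.
have k0 : (0 < k)%N by rewrite (leq_trans _ k2).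
have hD : D%:R * y ^+ k <= (2 ^+ 9) ^+ k.
  have x01 : 0 <= y / 32 <= 1 by lra.
  have := card_small_sets S k x01; rewrite -/D exprMn exprVn => h.
  have h32 : 0 < 32 ^+ k :> R by rewrite exprn_gt0.
  rewrite mulrA ler_pdivrMr// in h.
  apply: le_trans h _; have -> : 2 ^+ 9 = 2 ^+ 4 * 32 :> R by ring.
  rewrite exprMn ler_wpM2r ?(ltW h32)//.
  (* (1 + y / 32) ^ N <= exp (a / 32) <= exp (2 k) <= 16 ^ k *)
  have e2 : expR (2^-1 : R) <= 2.
    have := expR_ge1Dx (- 2^-1 : R); rewrite expRN => h.
    by rewrite -lef_pV2 ?posrE ?expR_gt0//; lra.
  apply: (@le_trans _ _ (expR (y / 32) ^+ N)).
    apply: lerXn2r; rewrite ?nnegrE; [lra|exact: expR_ge0|exact: expR_ge1Dx].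
  rewrite -exprM; apply: (@le_trans _ _ (expR 2^-1 ^+ (4 * k))); last first.
    by apply: lerXn2r; rewrite ?nnegrE//; exact: expR_ge0.
  rewrite -!expRM_natl ler_expR.
  have -> : N%:R * (y / 32) = a%:R / 32 :> R by rewrite /y; field.
  rewrite ler_pdivrMr// -mulrA mulrC.
  have -> : 2^-1 * 32 = 16%:R :> R by field.
  by rewrite -natrM ler_nat; lia.
have hC : 1 <= 'C(N, a)%:R * y ^+ (32 * k).
  have aN1 : (a <= N)%N by lia.
  apply: (@le_trans _ _ ('C(N, a)%:R * y ^+ a)).
    rewrite exprMn exprVn mulrA ler_pdivlMr ?exprn_gt0// mul1r.
    rewrite -!natrX -natrM ler_nat.
    exact: leq_bin_pow.
  by rewrite ler_wpM2l// ler_wiXn2l// ?(ltW y0)//; case/andP: ka.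
have hB : #|bad_at a|%:R * 'C(N, a)%:R <= 4 * D%:R ^+ 2 * #|{: {perm S}}|%:R :> R.
  have := card_bad_at a; rewrite -/k => h.
  have : (#|bad_at a| * 'C(N, a) <= (2 * D) ^ 2 * #|{: {perm S}}|)%N.
    by apply: leq_trans h _; rewrite leq_mul2r leq_exp2r// card_small_bdry orbT.
  have -> : 4 = 2 ^+ 2 :> R by ring.
  by rewrite -(ler_nat R) natrM [leRHS]natrM natrX natrM exprMn.
have C0 : 0 < 'C(N, a)%:R :> R by rewrite ltr0n bin_gt0; lia.
suff h : 4 * D%:R ^+ 2 * N%:R ^+ 2 <= 2 ^+ 14 * 'C(N, a)%:R :> R.
  rewrite -(ler_pM2r C0) mulrAC.
  apply: le_trans (ler_wpM2r (sqr_ge0 _) hB) _.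
  by rewrite mulrAC [leRHS]mulrAC ler_wpM2r.
have hy : y ^+ (30 * k) <= y ^+ 2 * 2^-1 ^+ (28 * k).
  have -> : (30 * k = 2 + (30 * k - 2))%N by lia.
  rewrite exprD ler_wpM2l ?sqr_ge0//.
  apply: (@le_trans _ _ (2^-1 ^+ (30 * k - 2))).
    by apply: lerXn2r; rewrite ?nnegrE ?(ltW y0).
  by apply: ler_wiXn2l; [lra|lra|lia].
have ha : N%:R ^+ 2 * y ^+ 2 <= 2 ^+ 12 * 2 ^+ (2 * k) :> R.
  have -> : N%:R ^+ 2 * y ^+ 2 = a%:R ^+ 2 by rewrite /y; field.
  have -> : 2 ^+ 12 * 2 ^+ (2 * k) = (64 * 2 ^ k)%N%:R ^+ 2 :> R.
    by rewrite natrM natrX exprMn -exprM mulnC; congr (_ * _); ring.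
  rewrite -!natrX ler_nat leq_exp2r//.
  by have := ltn_expl k (isT : 1 < 2)%N; lia.
have yk (j : nat) : 0 <= y ^+ j by rewrite exprn_ge0// ltW.
apply: (@le_trans _ _ (4 * D%:R ^+ 2 * N%:R ^+ 2 * ('C(N, a)%:R * y ^+ (32 * k)))).
  by rewrite ler_peMr// mulr_ge0 ?sqr_ge0// mulr_ge0// sqr_ge0.
have -> : 4 * D%:R ^+ 2 * N%:R ^+ 2 * ('C(N, a)%:R * y ^+ (32 * k)) =
    'C(N, a)%:R * (4 * (D%:R * y ^+ k) ^+ 2 * (N%:R ^+ 2 * y ^+ (30 * k))).
  have -> : (32 * k = k + k + 30 * k)%N by lia.
  by rewrite !exprD; ring.
rewrite [leRHS]mulrC ler_wpM2l ?(ltW C0)//.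
apply: (@le_trans _ _ (4 * ((2 ^+ 9) ^+ k) ^+ 2 *
    (2 ^+ 12 * 2 ^+ (2 * k) * 2^-1 ^+ (28 * k)))).
  apply: ler_pM.
  - by rewrite mulr_ge0// sqr_ge0.
  - by rewrite mulr_ge0// sqr_ge0.
  - by rewrite ler_wpM2l// lerXn2r ?nnegrE ?exprn_ge0// mulr_ge0.
  apply: (@le_trans _ _ (N%:R ^+ 2 * (y ^+ 2 * 2^-1 ^+ (28 * k)))).
    by rewrite ler_wpM2l// sqr_ge0.
  by rewrite mulrA ler_wpM2r// exprn_ge0.
have -> : 4 * ((2 ^+ 9) ^+ k) ^+ 2 * (2 ^+ 12 * 2 ^+ (2 * k) * 2^-1 ^+ (28 * k)) =
    2 ^+ 14 * 2^-1 ^+ (8 * k) :> R.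
  have -> : (28 * k = 9 * (k * 2) + 2 * k + 8 * k)%N by lia.
  rewrite -!exprM; set p := (9 * (k * 2))%N; set q := (2 * k)%N; set s := (8 * k)%N.
  clearbody p q s.
  by rewrite !exprVn 2!exprD; field; rewrite !expf_neq0.
by rewrite ler_piMr// ?exprn_ge0// exprn_ile1//; lra.
Qed.

End Counting.

Section NonExpanders.
Variables (R : realType) (S : finType) (l r : S -> S) (root : S).
Hypothesis bdry_inj : forall A B : {set S},
  bdry l r A = bdry l r B -> (root \in A) = (root \in B) -> A = B.

Definition non_expanders : {set {perm S}} :=
  \bigcup_(a < #|S| | (0 < a)%N && (a.*2 <= #|S|)%N) bad_at l r a.

Lemma expanderP sigma : sigma \notin non_expanders -> expander l r sigma.
Proof.
move=> good A A0 AS; rewrite ltnNge; apply: contra good => bA.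
have Alt : (#|A| < #|S|)%N by rewrite (leq_trans _ AS)// -addnn -addn1 leq_add2l.
apply/finset.bigcupP; exists (Ordinal Alt); first by rewrite /= A0.
by rewrite inE; apply/fintype.existsP; exists A; rewrite eqxx.
Qed.

Lemma card_non_expanders :
  #|non_expanders|%:R * #|S|%:R <= 2 ^+ 14 * #|{: {perm S}}|%:R :> R.
Proof.
have N0 : 0 < #|S|%:R :> R by rewrite ltr0n; apply/card_gt0P; exists root.
rewrite -(ler_pM2r N0) -mulrA -expr2.
have h : (#|non_expanders| <=
    \sum_(a < #|S| | (0 < a)%N && (a.*2 <= #|S|)%N) #|bad_at l r a|)%N.
  apply: (big_ind2 (fun (X : {set {perm S}}) n => #|X| <= n)%N) => //.
    by rewrite cards0.
  by move=> X m Y n Xm Yn; apply: leq_trans (leq_card_setU X Y) (leq_add Xm Yn).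
apply: (@le_trans _ _ ((\sum_(a < #|S| | (0 < a)%N && (a.*2 <= #|S|)%N)
    #|bad_at l r a|)%:R * #|S|%:R ^+ 2)).
  by rewrite ler_wpM2r ?sqr_ge0// ler_nat.
rewrite natr_sum mulr_suml.
apply: (@le_trans _ _ (\sum_(a < #|S|) 2 ^+ 14 * #|{: {perm S}}|%:R)); last first.
  by rewrite sumr_const card_ord -[leLHS]mulr_natr.
rewrite big_mkcond/=; apply: ler_sum => a _; case: ifP => [/andP[a0 aN]|_].
  exact: (card_bad_at_le bdry_inj).
by rewrite mulr_ge0// exprn_ge0.
Qed.
End NonExpanders.

(** The vertex k joins k - 1 to k + 1, and the vertex 0 joins 0 to 1, because
    left_nbr fixes 0. Hence x is joined to the truncated difference x - 2 and, by
    induction, membership is propagated from 0 to every x. *)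
Lemma segment_bdry_inj n (A B : {set seg n}) :
  bdry (@left_nbr n) (@right_nbr n) A = bdry (@left_nbr n) (@right_nbr n) B ->
  (ord0 \in A) = (ord0 \in B) -> A = B.
Proof.
move=> AB AB0; apply/setP => x.
suff h k : (k <= n.*2)%N -> (inord k \in A) = (inord k \in B).
  by rewrite -[x]inord_val h// -ltnS.
elim/ltn_ind: k => -[_ _|k IH kn].
  by rewrite (_ : inord 0 = ord0)//; apply: val_inj; rewrite /= inordK.
have kv : val (inord k : seg n) = k by rewrite /= inordK// ltnS ltnW.
have /setP/(_ (inord k)) := AB; rewrite !inE /left_nbr /right_nbr kv.
have kp : (k.-1 <= n.*2)%N by rewrite (leq_trans (leq_pred k))// ltnW.
rewrite (minn_idPl kn) (IH k.-1) ?ltnS ?leq_pred//.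
by case: (_ \in B); case: (_ \in A); case: (_ \in B).
Qed.

Lemma max_expected_hitting_time_expander (R : realType) n (sigma : {perm seg n})
    (X : forall x, markov_chain (permuted_walk R sigma) x) : (0 < n)%N ->
  expander (@left_nbr n) (@right_nbr n) sigma ->
  (max_expected_hitting_time X < (2 ^+ 22 * n%:R)%:E)%E.
Proof.
move=> n0 exp; apply: (@le_lt_trans _ _ (2 ^+ 20 * n.*2.+1%:R)%:E).
  apply: bigmax_le => [|x _]; first exact: leNye.
  apply: bigmax_le => [|y _]; first exact: leNye.
  exact: expander_hitting_time.
rewrite lte_fin; have -> : 2 ^+ 22 * n%:R = 2 ^+ 20 * (4 * n)%N%:R :> R.
  by rewrite natrM; ring.
by rewrite ltr_pM2l ?exprn_gt0// ltr_nat -muln2; lia.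
Qed.

Local Open Scope classical_set_scope.

Theorem theorem1 (R : realType) :
  exists C : R,
    forall X : forall (n : nat) (sigma : {perm seg n}) (x : seg n),
        markov_chain (permuted_walk R sigma) x,
      (fun n : nat =>
         uniform_measure R [pred sigma : {perm seg n} |
           (max_expected_hitting_time (X n sigma) < (C * n%:R)%:E)%E])
        @ \oo --> (1 : R).
Proof.
exists (2 ^+ 22) => X.
apply: (@squeeze_cvgr _ _ _ _ (fun n => 1 - 2 ^+ 14 * n.+1%:R^-1) (fun=> 1));
  last 2 first.
- rewrite -[X in _ --> X]subr0 -[X in _ - X](mulr0 (2 ^+ 14)).
  by apply: cvgB; [exact: cvg_cst|apply: cvgMr; exact: cvg_harmonic].
- exact: cvg_cst.
exists 1%N => // n /= n0; rewrite /uniform_measure.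
set good := [pred sigma | _].
have T0 : 0 < #|{: {perm seg n}}|%:R :> R.
  by rewrite ltr0n; apply/card_gt0P; exists 1%g.
rewrite ler_pdivrMr// ler_pdivlMr// mul1r ler_nat max_card andbT.
have := card_non_expanders R (@segment_bdry_inj n).
set bad := non_expanders _ _; rewrite card_ord => hb.
have hg : (#|{: {perm seg n}}| <= #|good| + #|bad|)%N.
  rewrite -(cardsC bad) addnC leq_add2r; apply: subset_leq_card.
  apply/fintype.subsetP => s; rewrite inE => /expanderP exp.
  by rewrite inE; exact: max_expected_hitting_time_expander.
have {}hb : #|bad|%:R <= 2 ^+ 14 * n.+1%:R^-1 * #|{: {perm seg n}}|%:R :> R.
  rewrite mulrAC ler_pdivlMr ?ltr0n//; apply: le_trans hb.
  by rewrite ler_wpM2l// ler_nat -muln2; lia.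
rewrite mulrBl mul1r lerBlDr; apply: le_trans (lerD (lexx _) hb).
by rewrite -natrD ler_nat.
Qed.
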